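(* Let $0\le i<j$ be indices of upstream boundary condition blocks, and suppose that $N_{c_{up}^j}(x_{n_{ini}},t')\le N_{c_{up}^i}(x_{n_{ini}},t')$ for some time $t'>t_j+\frac{x_{n_{ini}}-x_0}{v_f}$. Then $$\forall t>t',\qquad N_{c_{up}^j}(x_{n_{ini}},t)\le N_{c_{up}^i}(x_{n_{ini}},t).$$
   Context: Fundamental diagram: $Q:[0,k_{jam}]\to[0,\infty)$ is a concave function with $Q(0)=Q(k_{jam})=0$. The free-flow speed is $v_f=Q'(0^+)>0$ and the congested wave speed is $w>0$ with $-w=Q'(k_{jam}^-)$ (both finite). The convex transform of $Q$ is $R(u)=\sup_{k\in[0,k_{jam}]}(Q(k)-uk)$ for $u\in[-w,v_f]$. The road link is the interval $[x_0,x_{n_{ini}}]$ with $x_0<x_{n_{ini}}$. With $0=t_0<t_1<t_2<\dots$, the $j$-th upstream boundary condition block, imposed at $x=x_0$, is $c_{up}^j(t)=q_jt+d_j$ for $t_j\le t\le t_{j+1}$ and $+\infty$ otherwise. The flows satisfy $0\le q_j\le\max Q$ and consecutive blocks agree at their common endpoint. The solution component associated with block $j$ is given by the Lax-Hopf formula: for $x\in(x_0,x_{n_{ini}}]$ and $t>0$, $$N_{c_{up}^j}(x,t)=\inf\{c_{up}^j(s)+(t-s)R(\tfrac{x-x_0}{t-s}) : s\in[t_j,t_{j+1}],\ s<t,\ \tfrac{x-x_0}{t-s}\le v_f\},$$ with the infimum over the empty set equal to $+\infty$. *)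

(* Defs.v *)
From HB Require Import structures.
From mathcomp Require Import all_boot all_order all_algebra.
From mathcomp Require Import all_classical all_reals all_analysis.

Set Implicit Arguments.
Unset Strict Implicit.
Unset Printing Implicit Defensive.

Import Order.TTheory GRing.Theory Num.Theory.
Import numFieldNormedType.Exports.

Local Open Scope classical_set_scope.
Local Open Scope ring_scope.

(* A fundamental diagram is a function on [0, kjam]; it is encoded as a total
   function [Q : R -> R] of which only the values on [0, kjam] are ever used.
   [vf] and [- w] are its one-sided derivatives at the end points, as limits
   of difference quotients; [h^-1] is negative in the last field. *)
Record fundamental_diagram (R : realType) (Q : R -> R) (kjam vf w : R) : Prop :=
  FundamentalDiagram {
    fd_kjam_gt0 : 0 < kjam;
    fd_ge0 : forall k, k \in `[0, kjam] -> 0 <= Q k;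
    fd_concave : convex_function `[0, kjam] (fun k : R => - Q k);
    fd_0 : Q 0 = 0;
    fd_kjam : Q kjam = 0;
    fd_vf_gt0 : 0 < vf;
    fd_w_gt0 : 0 < w;
    fd_vf : (h^-1 * (Q h - Q 0)) @[h --> 0^'+] --> vf;
    fd_w : (h^-1 * (Q (kjam + h) - Q kjam)) @[h --> 0^'-] --> - w
  }.

Definition max_flow (R : realType) (Q : R -> R) (kjam : R) : R :=
  sup [set Q k | k in `[0, kjam]].

(* Meaningful for every [u], the set being nonempty and bounded above when [Q]
   is a fundamental diagram; it is only used for [- w <= u <= vf]. *)
Definition convex_transform (R : realType) (Q : R -> R) (kjam u : R) : R :=
  sup [set Q k - u * k | k in `[0, kjam]].

Record upstream_blocks (R : realType) (Q : R -> R) (kjam : R)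
    (tau q d : nat -> R) : Prop := UpstreamBlocks {
  ub_t0 : tau 0%N = 0;
  ub_incr : forall n, tau n < tau n.+1;
  ub_flow : forall n, 0 <= q n <= max_flow Q kjam;
  ub_agree : forall n,
    q n * tau n.+1 + d n = q n.+1 * tau n.+1 + d n.+1
}.

Definition c_up (R : realType) (tau q d : nat -> R) (j : nat) (s : R) : \bar R :=
  if tau j <= s <= tau j.+1 then (q j * s + d j)%:E else +oo%E.

Definition N_up (R : realType) (Q : R -> R) (kjam vf x0 : R)
    (tau q d : nat -> R) (j : nat) (x t : R) : \bar R :=
  ereal_inf
    [set (c_up tau q d j s
          + ((t - s) * convex_transform Q kjam ((x - x0) / (t - s)))%:E)%E
    | s in [set s | [/\ tau j <= s <= tau j.+1, s < t
                      & (x - x0) / (t - s) <= vf]]].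

(* Main.v *)
Require Import Defs.
From HB Require Import structures.
From mathcomp Require Import all_boot all_order all_algebra.
From mathcomp Require Import all_classical all_reals all_analysis.
From mathcomp Require Import ring lra.

(** Write [L = xn - x0] and [g a = a * R (L / a)], where [R] is the convex
    transform, so that the candidate issued at time [s] has value
    [c s + g (t - s)] at time [t].  Since [g a] is the supremum over [k]
    (finite, by [flow_le_twice_middle]) of the functions
    [a |-> a * Q k - L * k], which are affine in [a], [g] is convex, and its
    increment over a duration [h] grows with the starting point
    ([link_cost_increment_le], where [g] is [link_cost Q kjam L]).

    Blocks [i < j] are ordered in time: a candidate [s] of block [i] and a
    candidate [s'] of block [j] satisfy [s <= s'], hence [t - s' <= t - s].
    When the time moves from [t'] to [t], the value of the later candidate [s']
    therefore rises by at most as much as that of the earlier candidate [s].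
    Thus the rise [D] of a given [s] satisfies [N_j t - D <= N_j t'], and
    [N_j t' <= N_i t'] bounds [N_j t - D] by the value of [s] at [t'].  This
    bound needs [s] to be already a candidate at [t'], which is the role of
    the condition [t' > tau j + L / vf]: a wave issued at or before [tau j]
    at speed [vf] has reached [xn] by then. *)

Set Implicit Arguments.
Unset Strict Implicit.
Unset Printing Implicit Defensive.

Import Order.TTheory GRing.Theory Num.Theory.
Import numFieldNormedType.Exports.

Local Open Scope classical_set_scope.
Local Open Scope ring_scope.

(** The middle of [0, kjam] is also the midpoint of [k] and [kjam - k], so
    concavity there bounds [Q k + Q (kjam - k)], and the second term is
    nonnegative. *)
Lemma flow_le_twice_middle (R : realType) (Q : R -> R) (kjam vf w k : R) :
  fundamental_diagram Q kjam vf w -> k \in `[0, kjam] ->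
  Q k <= 2 * Q (kjam / 2).
Proof.
move=> HQ kI; have kI' : kjam - k \in `[0, kjam].
  by move: kI; rewrite !in_itv /= => /andP[? ?]; apply/andP; split; lra.
have half01 : (0 <= 2^-1 :> R) && (2^-1 <= 1 :> R) by apply/andP; split; lra.
have mid : - Q (2^-1 * k + (1 - 2^-1) * (kjam - k)) <=
    2^-1 * - Q k + (1 - 2^-1) * - Q (kjam - k).
  by apply: (fd_concave HQ (Itv01 (andP half01).1 (andP half01).2)); rewrite inE.
have {}mid : - Q (kjam / 2) <= 2^-1 * - Q k + (1 - 2^-1) * - Q (kjam - k).
  apply: le_trans mid; rewrite le_eqVlt; apply/orP; left; apply/eqP.
  by congr (- Q _); field.
have := fd_ge0 HQ kI'.
lra.
Qed.

Lemma has_sup_convex_transform (R : realType) (Q : R -> R) (kjam vf w u : R) :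
  fundamental_diagram Q kjam vf w ->
  has_sup [set Q k - u * k | k in `[0, kjam]].
Proof.
move=> HQ; split.
  by exists (Q 0 - u * 0), 0 => //=; rewrite in_itv /= lexx ltW // (fd_kjam_gt0 HQ).
exists (2 * Q (kjam / 2) + `|u| * kjam) => _ [k /= kI <-].
apply: lerD; first exact: flow_le_twice_middle HQ kI.
move: kI; rewrite in_itv /= => /andP[k0 kle].
rewrite (le_trans (ler_norm _)) // normrN normrM (ger0_norm k0).
by rewrite ler_wpM2l.
Qed.

(** The perspective of the convex transform: the label increment along a wave
    that crosses a link of length [L] in time [a]. *)
Definition link_cost (R : realType) (Q : R -> R) (kjam L a : R) : R :=
  a * convex_transform Q kjam (L / a).

Lemma link_cost_ge (R : realType) (Q : R -> R) (kjam vf w L a k : R) :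
  fundamental_diagram Q kjam vf w -> 0 < a -> k \in `[0, kjam] ->
  a * Q k - L * k <= link_cost Q kjam L a.
Proof.
move=> HQ a0 kI; have -> : a * Q k - L * k = a * (Q k - L / a * k).
  by field; rewrite gt_eqF.
rewrite ler_pM2l //; apply: ub_le_sup; last by exists k.
by have [] := has_sup_convex_transform (L / a) HQ.
Qed.

Lemma link_cost_le (R : realType) (Q : R -> R) (kjam vf w L a B : R) :
  fundamental_diagram Q kjam vf w -> 0 < a ->
  (forall k, k \in `[0, kjam] -> a * Q k - L * k <= B) ->
  link_cost Q kjam L a <= B.
Proof.
move=> HQ a0 leB; rewrite /link_cost mulrC -ler_pdivlMr //.
apply: ge_sup => [|_ [k /= kI <-]].
  by have [] := has_sup_convex_transform (L / a) HQ.
rewrite ler_pdivlMr //; apply: le_trans (leB k kI).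
by rewrite le_eqVlt; apply/orP; left; apply/eqP; field; rewrite gt_eqF.
Qed.

(** This is convexity of [link_cost] in the crossing time, in the form of
    increasing increments.  Densities [k], tried at [a + h], and [l], tried at
    [b], are also competitors on the right-hand side: if [Q k <= Q l], use [k]
    at [a] and [l] at [b + h], so that the larger flow gets the longer time; if
    not, use [l] at [a] and [k] at [b + h].  Either way the sum does not
    decrease. *)
Lemma link_cost_increment_le (R : realType) (Q : R -> R) (kjam vf w L a b h : R) :
  fundamental_diagram Q kjam vf w -> 0 < a -> a <= b -> 0 <= h ->
  link_cost Q kjam L (a + h) + link_cost Q kjam L b <=
  link_cost Q kjam L a + link_cost Q kjam L (b + h).
Proof.
move=> HQ a0 ab h0; have b0 : 0 < b := lt_le_trans a0 ab.
have bh0 : 0 < b + h by rewrite ltr_pwDl.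
rewrite -lerBrDr; apply: (link_cost_le HQ); first by rewrite ltr_pwDl.
move=> k kI; rewrite lerBrDr addrC -lerBrDr; apply: (link_cost_le HQ) => // l lI.
rewrite lerBrDr.
have [Qkl|/ltW Qlk] := leP (Q k) (Q l).
  have := link_cost_ge L HQ a0 kI; have := link_cost_ge L HQ bh0 lI.
  have : 0 <= h * (Q l - Q k) by rewrite mulr_ge0 // subr_ge0.
  by lra.
have := link_cost_ge L HQ a0 lI; have := link_cost_ge L HQ bh0 kI.
have : 0 <= (b - a) * (Q k - Q l) by rewrite mulr_ge0 // subr_ge0.
by lra.
Qed.

Theorem theorem3 (R : realType) (Q : R -> R) (kjam vf w x0 xn : R)
  (tau q d : nat -> R) (i j : nat) (t' : R)
  (HQ : fundamental_diagram Q kjam vf w)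
  (Hx : x0 < xn)
  (Hb : upstream_blocks Q kjam tau q d)
  (Hij : (i < j)%N)
  (Ht' : tau j + (xn - x0) / vf < t')
  (HN : (N_up Q kjam vf x0 tau q d j xn t'
         <= N_up Q kjam vf x0 tau q d i xn t')%E) :
  forall t : R, t' < t ->
    (N_up Q kjam vf x0 tau q d j xn t
     <= N_up Q kjam vf x0 tau q d i xn t)%E.
Proof.
move=> t t't; have vf0 := fd_vf_gt0 HQ.
have L0 : 0 < xn - x0 by rewrite subr_gt0.
have tau_homo : {homo tau : m n / (m <= n)%N >-> m <= n}.
  by apply: homo_leq => // [y x z|n]; [exact: le_trans|exact/ltW/(ub_incr Hb)].
have tauij : tau i.+1 <= tau j := tau_homo _ _ Hij.
apply: le_ereal_inf_tmp => _ [s [sI st _] <-].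
have sj : s <= tau j by case/andP: sI => _ /le_trans; apply.
have Lvf0 : 0 < (xn - x0) / vf by rewrite divr_gt0.
have st' : s < t' by lra.
have feas : (xn - x0) / (t' - s) <= vf.
  rewrite ler_pdivrMr ?subr_gt0 // mulrC -ler_pdivrMr //; lra.
rewrite /c_up sI -/(link_cost Q kjam (xn - x0) (t - s)).
set g := link_cost Q kjam (xn - x0).
(* Candidates of block [j] at [t'] remain candidates at [t], and they rise by
   no more than the rise of [s], because they were issued after it. *)
have rise : (N_up Q kjam vf x0 tau q d j xn t - (g (t - s) - g (t' - s))%:E
             <= N_up Q kjam vf x0 tau q d j xn t')%E.
  apply: le_ereal_inf_tmp => _ [s' [s'I s't' feas'] <-].
  have s't : s' < t := lt_trans s't' t't.
  have feast : (xn - x0) / (t - s') <= vf.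
    apply: le_trans feas'; rewrite ler_pM2l // lef_pV2 ?posrE ?subr_gt0 //.
    by rewrite lerD2r ltW.
  rewrite leeBlDr //; apply: (@le_trans _ _ (c_up tau q d j s' + (g (t - s'))%:E)%E).
    by apply: ereal_inf_lbound; exists s'.
  rewrite /c_up s'I -/(link_cost Q kjam (xn - x0) (t' - s')) -/g -!EFinD lee_fin.
  have ss' : s <= s' by case/andP: s'I => js' _; exact: le_trans sj js'.
  have := @link_cost_increment_le _ _ _ _ _ (xn - x0)
            (t' - s') (t' - s) (t - t') HQ.
  rewrite subr_gt0 s't' lerD2l lerN2 ss' subr_ge0 ltW // => /(_ isT isT isT).
  have -> : t' - s' + (t - t') = t - s' by ring.
  have -> : t' - s + (t - t') = t - s by ring.
  by rewrite -/g; lra.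
have le_s : (N_up Q kjam vf x0 tau q d i xn t'
             <= (q i * s + d i)%:E + (g (t' - s))%:E)%E.
  by apply: ereal_inf_lbound; exists s => //; rewrite /c_up sI.
have := le_trans (le_trans rise HN) le_s.
rewrite leeBlDr // -!EFinD => /le_trans; apply.
by rewrite lee_fin; lra.
Qed.
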